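(* Let $\epsilon_0>0$ be fixed, let $\eta_n\to 0$, and let $K=K_n\ge2$, $a=a_n$, $b=b_n$ satisfy $\epsilon_0<b<a$, $a/n<1-\epsilon_0$ and $\frac{nI}{K\log K}\to\infty$. Let $\hat\sigma\in\arg\max_{\sigma\in\Theta^0(n,K,a,b)}T(\sigma)$ be the penalized likelihood estimator with $\lambda$ given by the formula below (any fixed $w\in[0,1]$ when $K\ge 3$). Then $$\sup_{\sigma\in\Theta^0(n,K,a,b)}\mathbb{E}\, r(\hat\sigma,\sigma)\le\exp\Big(-(1+o(1))\frac{nI}{K}\Big).$$
   Context: SBM: for an assignment $\sigma:[n]\to[K]$ and probabilities $\{\theta_{i,j}\}$, one observes symmetric $A\in\{0,1\}^{n\times n}$ with $A_{i,i}=0$ and independent $A_{i,j}\sim\mathrm{Ber}(\theta_{i,j})$, $i<j$. $\Theta^0(n,K,a,b)$ (tolerance $\eta_n\to0$): assignments $\sigma$ with community sizes $n_k=|\{i:\sigma(i)=k\}|\in[(1-\eta_n)\frac nK,(1+\eta_n)\frac nK]$ for all $k$, with $\theta_{i,j}=a/n$ if $\sigma(i)=\sigma(j)$ and $b/n$ otherwise ($i\ne j$). $I=-2\log\big(\sqrt{\frac{a}{n}\frac{b}{n}}+\sqrt{(1-\frac{a}{n})(1-\frac{b}{n})}\big)$. $T(\sigma)=\sum_{i<j}A_{i,j}\mathbf 1\{\sigma(i)=\sigma(j)\}-\lambda\sum_{i<j}\mathbf 1\{\sigma(i)=\sigma(j)\}$, $t^\star=\frac12\log\frac{a(1-b/n)}{b(1-a/n)}$,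 $$\lambda=\begin{cases}-\frac{1}{2t^\star}\log\big(\frac an e^{-t^\star}+1-\frac an\big)+\frac{1}{2t^\star}\log\big(\frac bn e^{t^\star}+1-\frac bn\big), & K=2,\\ -\frac{w}{t^\star}\log\big(\frac an e^{-t^\star}+1-\frac an\big)+\frac{1-w}{t^\star}\log\big(\frac bn e^{t^\star}+1-\frac bn\big), & K\ge3,\end{cases}$$ $w\in[0,1]$ constant; ties broken arbitrarily. $r(\sigma,\hat\sigma)=\min_\delta d_H(\sigma,\delta\circ\hat\sigma)/n$ over permutations $\delta$ of $[K]$. ''$\exp(-(1+o(1))G)$'' means $\exp(-(1+\delta_n)G)$ for some $\delta_n\to0$. *)

(* Defs.v *)
From mathcomp Require Import all_boot all_fingroup.
From Stdlib Require Import Reals.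
Set Implicit Arguments. Unset Strict Implicit. Unset Printing Implicit Defensive.

(* adjacency matrices on n vertices (all Boolean n x n arrays; the SBM law
   below gives weight 0 to non-symmetric ones or ones with nonzero diagonal) *)
Definition adj (n : nat) := {ffun 'I_n * 'I_n -> bool}.
Definition assign (n K : nat) := {ffun 'I_n -> 'I_K}.

Definition Rsum (T : finType) (P : pred T) (F : T -> R) : R :=
  \big[Rplus/0%R]_(x : T | P x) F x.
Definition Rprod (T : finType) (P : pred T) (F : T -> R) : R :=
  \big[Rmult/1%R]_(x : T | P x) F x.

Definition upper (n : nat) : pred ('I_n * 'I_n) := fun p => (p.1 < p.2)%N.
Arguments upper n : clear implicits.

Definition comm_size n K (s : assign n K) (k : 'I_K) : nat :=
  #|[set i | s i == k]|.

(* sigma in Theta^0(n,K,a,b) with tolerance eta (the parameters a,b only fix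
   the connection probabilities, see [theta]) *)
Definition Theta0 n K (eta : R) (s : assign n K) : Prop :=
  forall k : 'I_K,
    ((1 - eta) * INR n / INR K <= INR (comm_size s k)
     <= (1 + eta) * INR n / INR K)%R.

Definition theta n K (a b : R) (s : assign n K) (i j : 'I_n) : R :=
  if s i == s j then (a / INR n)%R else (b / INR n)%R.

Definition valid_adj n (A : adj n) : bool :=
  [forall i, forall j, A (i, j) == A (j, i)] && [forall i, ~~ A (i, i)].

Definition prob_adj n K (a b : R) (s : assign n K) (A : adj n) : R :=
  if valid_adj A then
    Rprod (upper n) (fun p => if A p then theta a b s p.1 p.2
                              else (1 - theta a b s p.1 p.2)%R)
  else 0%R.

Definition expect n K (a b : R) (s : assign n K) (f : adj n -> R) : R :=
  Rsum predT (fun A => prob_adj a b s A * f A)%R.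

Definition indR (b : bool) : R := if b then 1%R else 0%R.

Definition T_stat n K (lam : R) (A : adj n) (s : assign n K) : R :=
  (Rsum (upper n) (fun p => indR (A p) * indR (s p.1 == s p.2))
   - lam * Rsum (upper n) (fun p => indR (s p.1 == s p.2)))%R.

Definition risk n K (s t : assign n K) : R :=
  (INR (\big[minn/n]_(d : {perm 'I_K}) #|[set i | s i != d (t i)]|) / INR n)%R.

Definition I_rate (n : nat) (a b : R) : R :=
  (- 2 * ln (sqrt (a / INR n * (b / INR n))
             + sqrt ((1 - a / INR n) * (1 - b / INR n))))%R.

Definition tstar (n : nat) (a b : R) : R :=
  (/ 2 * ln (a * (1 - b / INR n) / (b * (1 - a / INR n))))%R.

Definition lambda_pen (n K : nat) (w a b : R) : R :=
  let t := tstar n a b in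
  if K == 2 then
    (- (1 / (2 * t)) * ln (a / INR n * exp (- t) + 1 - a / INR n)
     + (1 / (2 * t)) * ln (b / INR n * exp t + 1 - b / INR n))%R
  else
    (- (w / t) * ln (a / INR n * exp (- t) + 1 - a / INR n)
     + ((1 - w) / t) * ln (b / INR n * exp t + 1 - b / INR n))%R.

(* Main.v *)
(** Write N = n/K, G = nI/K and let s range over assignments whose labels are
   already matched optimally to the truth s0, so that m = d_H(s, s0) is the
   number of errors.  The tilt t* together with lambda is chosen such that the
   Chernoff bound for T(s) >= T(s0) costs a factor exp(-v I) for every pair
   joined by s only and exp(-(1-v) I) for every pair joined by s0 only, with
   v = w for K >= 3 and v = 1/2 for K = 2.  Both kinds of pairs number at least
   m (N - m), up to the tolerance, and at least m N / 10 whatever m is.  There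
   are at most (enK/m)^m assignments at distance m.  Errors below
   n exp(-(1-4 eps) G) are affordable outright; above that threshold the union
   bound is geometric in m: for m <= eps N by the first pair count, and for
   larger m by the second one together with G >> log K. *)

From HB Require Import structures.
Require Import Defs.
From mathcomp Require Import zify.
From Stdlib Require Import Reals Lra ClassicalEpsilon.
From mathcomp Require Import all_boot all_fingroup.
(* The last import rebinds %R to the ring scope of MathComp. *)
Delimit Scope R_scope with R.
Set Implicit Arguments. Unset Strict Implicit. Unset Printing Implicit Defensive.

(** * Pairs separated by two assignments *)

Definition dist (n K : nat) (s s' : assign n K) : nat := #|[set i | s i != s' i]|.

Definition relabel (n K : nat) (d : {perm 'I_K}) (s : assign n K) : assign n K :=
  [ffun i => d (s i)].

Definition sep (n K : nat) (s s' : assign n K) : nat :=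
  #|[set p | upper n p & (s p.1 == s p.2) && (s' p.1 != s' p.2)]|.

Definition sep_at (n K : nat) (s s' : assign n K) (i : 'I_n) : nat :=
  #|[set j | (s j == s i) && (s' j != s' i)]|.

(** Every unordered pair is seen once from each endpoint, and the diagonal contributes nothing
    because [s' i != s' i] is false. *)
Lemma sum_sep_at (n K : nat) (s s' : assign n K) :
  \sum_i sep_at s s' i = (sep s s').*2.
Proof.
have -> : \sum_i sep_at s s' i =
    \sum_(p : 'I_n * 'I_n) ((s p.1 == s p.2) && (s' p.1 != s' p.2)).
  rewrite -(pair_bigA _ (fun i j => ((s i == s j) && (s' i != s' j) : nat))) /=.
  apply: eq_bigr => i _; rewrite /sep_at -sum1dep_card big_mkcond.
  by apply: eq_bigr => j _; rewrite eq_sym (eq_sym (s' j)); case: (_ && _).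
rewrite (bigID (upper n)) /=.
rewrite [X in _ + X](reindex_inj (h := fun p => (p.2, p.1))) /=; last first.
  by move=> [x y] [x' y'] [-> ->].
rewrite -addnn /sep -sum1dep_card big_mkcondr.
congr (_ + _).
transitivity (\sum_(p : 'I_n * 'I_n | upper n p)
     (if (s p.1 == s p.2) && (s' p.1 != s' p.2) then 1 else 0)); last by [].
rewrite big_mkcond [RHS]big_mkcond; apply: eq_bigr => -[i j] _ /=.
rewrite /upper /= -leqNgt eq_sym (eq_sym (s' j)).
case: (ltngtP i j) => [//|//|/val_inj ->].
by rewrite !eqxx.
Qed.

(** A vertex on which [s] and [s'] differ is separated by [s'] from every agreeing vertex of its
    [s]-class, and there are at least L - m of those. *)
Lemma sep_lower_small (n K : nat) (s s' : assign n K) (L : nat) :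
  (forall k, L <= comm_size s k) ->
  dist s s' * L <= sep s s' + dist s s' * dist s s'.
Proof.
move=> hL; set m := dist s s'; set M := [set i | s i != s' i].
have hcorr i : L <= #|[set j | (s j == s i) && (j \notin M)]| + m.
  apply: leq_trans (hL (s i)) _; rewrite /comm_size -(cardsID M) addnC.
  apply: leq_add; apply: subset_leq_card; apply/subsetP => j; rewrite !inE.
    by case/andP=> -> ->.
  by case/andP.
have hM i : i \in M ->
   #|[set j | (s j == s i) && (j \notin M)]| <= sep_at s s' i.
  rewrite inE => hi; apply: subset_leq_card; apply/subsetP => j; rewrite !inE negbK.
  by case/andP=> /eqP sj /eqP s'j; rewrite sj eqxx /= -s'j sj.
(* The same mixed pairs, counted from their agreeing endpoint. Together with the count from the
   other endpoint this compensates for the factor 2 in [sum_sep_at]. *)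
have hC : \sum_(i in M) #|[set j | (s j == s i) && (j \notin M)]|
    <= \sum_(j | j \notin M) sep_at s s' j.
  rewrite (eq_bigr (fun i => \sum_(j | j \notin M) (s j == s i))); last first.
    move=> i _; rewrite -sum1dep_card big_mkcondl [RHS]big_mkcond [LHS]big_mkcond.
    by apply: eq_bigr => j _; case: (s j == s i); case: (j \notin M).
  rewrite exchange_big /=; apply: leq_sum => j; rewrite inE negbK => /eqP hj.
  rewrite /sep_at -sum1dep_card big_mkcond [X in _ <= X]big_mkcond.
  apply: leq_sum => i _; rewrite inE (eq_sym (s j)) -hj.
  case: (eqVneq (s i) (s' i)) => //= ni; case: eqVneq => //= ij.
  by rewrite -ij eq_sym ni.
have h1 : m * L <= \sum_(i in M) #|[set j | (s j == s i) && (j \notin M)]| + m * m.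
  rewrite -[m in m * L]/(#|M|) -[X in _ <= _ + X * _]/(#|M|) -!sum_nat_const -big_split /=.
  by apply: leq_sum.
have h2 : (\sum_(i in M) #|[set j | (s j == s i) && (j \notin M)]|).*2 <= (sep s s').*2.
  rewrite -sum_sep_at -addnn [X in _ <= X](bigID (mem M)) /=; apply: leq_add => //.
  exact: leq_sum.
by rewrite leq_double in h2; lia.
Qed.

(** Take a permutation agreeing with [f] at as many points of [P] as possible. If it failed at k,
    composing it with the transposition of [d k] and [f k] would repair k and, by injectivity, spoil
    no other point. *)
Lemma extend_to_perm (T : finType) (P : pred T) (f : T -> T) :
  {in P &, injective f} -> exists d : {perm T}, {in P, d =1 f}.
Proof.
move=> finj.
have [d _ dmax] := arg_maxnP (fun d : {perm T} => #|[set k in P | d k == f k]|)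
  (erefl : predT (1%g : {perm T})).
exists d => k kP; apply/eqP; apply/negPn/negP => dk.
have := dmax (d * tperm (d k) (f k))%g erefl; rewrite /= leqNgt => /negP; apply.
apply: proper_card; apply/properP; split.
  apply/subsetP => j; rewrite !inE => /andP[jP /eqP dj]; rewrite jP permM /= tpermD ?dj //.
    rewrite -dj (inj_eq perm_inj); apply: contraNneq dk => kj.
    by rewrite kj dj.
  apply: contraNneq dk => /finj kj; by rewrite (kj kP jP) dj.
by exists k; rewrite !inE ?(negbTE dk) ?andbF // permM tpermL eqxx andbT.
Qed.

(** Let [f k] be the [s']-label most frequent in class k of [s], and [D k] the number of points of
    the class outside it. Each point of class k is separated from at least [D k] others, so L times
    the sum of [D] is at most twice [sep s s']. Relabelling along [f] costs at most 4 times that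
    sum. *)
Lemma sep_lower_large (n K : nat) (s s' : assign n K) (L U : nat) :
  (forall k, L <= comm_size s k <= U) -> (forall k, comm_size s' k <= U) ->
  3 * U <= 4 * L ->
  exists d : {perm 'I_K}, L * dist s' (relabel d s) <= 8 * sep s s'.
Proof.
move=> hs hs' hUL.
pose ov k l := #|[set i | (s i == k) && (s' i == l)]|.
pose f k := [arg max_(l > k) ov k l].
have hf k l : ov k l <= ov k (f k) by rewrite /f; case: arg_maxnP => // j _; apply.
have hov k l : ov k l <= comm_size s k.
  by apply: subset_leq_card; apply/subsetP => i; rewrite !inE => /andP[].
pose D k := comm_size s k - ov k (f k).
(* On [P] the largest overlap exceeds U/2, so two such classes cannot share a label whose [s']-class
   has at most U points. *)
pose P := [pred k | 2 * D k + U < 2 * L].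
have finj : {in P &, injective f}.
  move=> k k' kP k'P fkk'; apply/eqP; apply/negPn/negP => nkk'.
  have : ov k (f k) + ov k' (f k') <= U.
    apply: leq_trans (hs' (f k)); rewrite -fkk' /ov -cardsUI.
    rewrite [X in _ + #|pred_of_set X|](_ : _ = set0) ?cards0 ?addn0.
      apply: subset_leq_card; apply/subsetP => i; rewrite !inE.
      by case/orP => /andP[].
    apply/setP => i; rewrite !inE; apply/negP => /andP[/andP[/eqP-> _] /andP[/eqP e _]].
    by rewrite e eqxx in nkk'.
  move: kP k'P (hs k) (hs k') (hov k (f k)) (hov k' (f k')); rewrite !inE /D; lia.
have [d dP] := extend_to_perm finj.
exists d.
(* Off [P] the label [d k] is uncontrolled, but there 4 [D k] >= 4L - 2U >= U already covers the
   whole class. *)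
have hd k : comm_size s k - ov k (d k) <= 4 * D k.
  have [kP|kP] := boolP (k \in P); first by rewrite dP // -/(D k); lia.
  by move: kP (hs k); rewrite !inE -leqNgt; lia.
have dE : dist s' (relabel d s) = \sum_k (comm_size s k - ov k (d k)).
  rewrite /dist -sum1_card (partition_big s predT) //=.
  apply: eq_bigr => k _; rewrite sum1dep_card.
  rewrite /comm_size -(cardsID [set i | s' i == d k] [set i | s i == k]).
  have -> : ov k (d k) = #|[set i | s i == k] :&: [set i | s' i == d k]|.
    by apply: eq_card => i; rewrite !inE.
  rewrite addnC addnK; apply: eq_card => i; rewrite !inE ffunE.
  by case: (eqVneq (s i) k) => [->|]; rewrite ?andbF ?andbT.
have hsep : L * \sum_k D k <= (sep s s').*2.
  rewrite -sum_sep_at (partition_big s predT) //= big_distrr /=.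
  apply: leq_sum => k _.
  apply: (@leq_trans (\sum_(i | s i == k) D k)).
    rewrite sum_nat_cond_const leq_mul2r; apply/orP; right.
    case/andP: (hs k) => + _; move/leq_trans; apply.
    by apply: subset_leq_card; apply/subsetP=> i; rewrite !inE.
  apply: leq_sum => i /eqP si; rewrite leq_subLR /sep_at si.
  apply: leq_trans (_ : ov k (s' i) + _ <= _); last by apply: leq_add; [exact: hf|exact: leqnn].
  rewrite /comm_size -(cardsID [set j | s' j == s' i]) leq_add //.
    by apply: subset_leq_card; apply/subsetP=> j; rewrite !inE.
  by apply: subset_leq_card; apply/subsetP=> j; rewrite !inE andbC.
have : dist s' (relabel d s) <= 4 * \sum_k D k.
  by rewrite dE big_distrr /=; apply: leq_sum.
by rewrite -muln2 in hsep; nia.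
Qed.

Local Open Scope R_scope.

(** * Real sums and products over finite types *)

Lemma RplusA : associative Rplus. Proof. by move=> *; rewrite Rplus_assoc. Qed.
Lemma RmultA : associative Rmult. Proof. by move=> *; rewrite Rmult_assoc. Qed.
HB.instance Definition _ := Monoid.isComLaw.Build R 0 Rplus RplusA Rplus_comm Rplus_0_l.
HB.instance Definition _ := Monoid.isComLaw.Build R 1 Rmult RmultA Rmult_comm Rmult_1_l.
HB.instance Definition _ := Monoid.isMulLaw.Build R 0 Rmult Rmult_0_l Rmult_0_r.
HB.instance Definition _ := Monoid.isAddLaw.Build R Rmult Rplus Rmult_plus_distr_r Rmult_plus_distr_l.

Lemma Rsum_ge0 (I : finType) (P : pred I) (F : I -> R) :
  (forall i, P i -> 0 <= F i) -> 0 <= \big[Rplus/0]_(i | P i) F i.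
Proof. by move=> h; apply: big_ind => // *; lra. Qed.

Lemma ler_Rsum (I : finType) (P : pred I) (F G : I -> R) :
  (forall i, P i -> F i <= G i) ->
  \big[Rplus/0]_(i | P i) F i <= \big[Rplus/0]_(i | P i) G i.
Proof. by move=> h; apply: (big_ind2 Rle) => // *; lra. Qed.

Lemma Rprod_ge0 (I : finType) (P : pred I) (F : I -> R) :
  (forall i, P i -> 0 <= F i) -> 0 <= \big[Rmult/1]_(i | P i) F i.
Proof. by move=> h; apply: big_ind => // *; [lra|apply: Rmult_le_pos]. Qed.

Lemma Rsum_term_le (I : finType) (P : pred I) (F : I -> R) i0 :
  (forall i, P i -> 0 <= F i) -> P i0 -> F i0 <= \big[Rplus/0]_(i | P i) F i.
Proof.
move=> h Pi0; rewrite (bigD1 i0) //= -[X in X <= _]Rplus_0_r.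
by apply: Rplus_le_compat_l; apply: Rsum_ge0 => i /andP[/h].
Qed.

Lemma Rsum_inj_le (I J : finType) (P : pred I) (h : I -> J) (F : J -> R) :
  {in P &, injective h} -> (forall j, 0 <= F j) ->
  \big[Rplus/0]_(i | P i) F (h i) <= \big[Rplus/0]_j F j.
Proof.
move=> hinj F0; rewrite -[X in X <= _](big_imset F) //= [X in _ <= X](bigID (mem [set h x | x in P])) /=.
by rewrite -[X in X <= _]Rplus_0_r; apply: Rplus_le_compat_l; apply: Rsum_ge0.
Qed.

Lemma exp_Rsum (I : finType) (P : pred I) (F : I -> R) :
  exp (\big[Rplus/0]_(i | P i) F i) = \big[Rmult/1]_(i | P i) exp (F i).
Proof. by apply: (big_morph exp); [exact: exp_plus | exact: exp_0]. Qed.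

Lemma INR_sum (I : finType) (P : pred I) (F : I -> nat) :
  INR (\sum_(i | P i) F i) = \big[Rplus/0]_(i | P i) INR (F i).
Proof. by apply: (big_morph INR) => // x y; rewrite plus_INR. Qed.

Lemma Rsum_const (I : finType) (P : pred I) (c : R) :
  \big[Rplus/0]_(i | P i) c = INR #|P| * c.
Proof.
rewrite -sum1_card INR_sum (big_distrl (times := Rmult)) /=.
by apply: eq_bigr => i _; rewrite Rmult_1_l.
Qed.

Lemma Rprod_const (I : finType) (P : pred I) (c : R) :
  \big[Rmult/1]_(i | P i) c = c ^ #|P|.
Proof. by rewrite big_const; elim: #|P| => //= k ->. Qed.

Lemma exp_le (x y : R) : x <= y -> exp x <= exp y.
Proof. by case=> [/exp_increasing|->]; lra. Qed.

Lemma Rle_INR (m k : nat) : (m <= k)%N -> INR m <= INR k.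
Proof. by move=> mk; apply: le_INR; lia. Qed.

Lemma INR_leq (m k : nat) : INR m <= INR k -> (m <= k)%N.
Proof. by move/INR_le; lia. Qed.

Lemma pow_exp (x : R) (m : nat) : exp x ^ m = exp (INR m * x).
Proof.
elim: m => [|m IH]; first by rewrite Rmult_0_l exp_0.
by rewrite -tech_pow_Rmult IH -exp_plus S_INR; congr exp; ring.
Qed.

Lemma INR_gt0 (m : nat) : (0 < m)%N -> 0 < INR m.
Proof. by move=> m0; apply: (lt_INR 0); lia. Qed.

(** * Chernoff bound for the block model *)

Section Law.
Variables (n K : nat) (a b : R) (s : assign n K).
Hypothesis theta01 : forall i j, 0 <= theta a b s i j <= 1.

Lemma prob_adj_ge0 A : 0 <= prob_adj a b s A.
Proof.
rewrite /prob_adj; case: ifP => _; last lra.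
by apply: Rprod_ge0 => p _; move: (theta01 p.1 p.2); case: (A p) => ?; lra.
Qed.

Lemma valid_adj_upper_inj (A A' : adj n) : valid_adj A -> valid_adj A' ->
  (forall p, upper n p -> A p = A' p) -> A = A'.
Proof.
move=> /andP[/forallP symA /forallP dA] /andP[/forallP symA' /forallP dA'] h.
apply/ffunP => -[i j]; case: (ltngtP i j) => [ij|ji|/val_inj ->].
- exact: h.
- by rewrite (eqP (forallP (symA i) j)) (eqP (forallP (symA' i) j)) h.
- by rewrite (negbTE (dA j)) (negbTE (dA' j)).
Qed.

(* Only an inequality is claimed: it suffices, and avoids exhibiting the
   inverse of the restriction of symmetric arrays to i < j. *)
Lemma expect_prod_le (g : 'I_n * 'I_n -> bool -> R) :
  (forall p c, 0 <= g p c) ->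
  expect a b s (fun A => \big[Rmult/1]_(p | upper n p) g p (A p))
  <= \big[Rmult/1]_(p | upper n p)
       (theta a b s p.1 p.2 * g p true + (1 - theta a b s p.1 p.2) * g p false).
Proof.
move=> g0.
pose th p := theta a b s p.1 p.2.
(* Off the upper triangle the value false is forced with weight 1, so the product of sums may run
   over all entries. A valid array is then encoded by its restriction to the upper triangle. *)
pose f p c : R := if upper n p then (if c then th p else 1 - th p) * g p c
                  else if c then 0 else 1.
have f0 p c : 0 <= f p c.
  rewrite /f; case: ifP => _; last by case: c; lra.
  apply: Rmult_le_pos => //.
  by move: (theta01 p.1 p.2); rewrite /th; case: c; lra.
have -> : \big[Rmult/1]_(p | upper n p) (th p * g p true + (1 - th p) * g p false)
   = \big[Rmult/1]_p \big[Rplus/0]_(c : bool) f p c.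
  rewrite big_mkcond /=; apply: eq_bigr => p _.
  by rewrite big_bool /= /f; case: ifP => _ //=; lra.
rewrite (bigA_distr_bigA (times := Rmult)) /=.
pose rst (A : adj n) : adj n := [ffun p => upper n p && A p].
apply: (@Rle_trans _ (\big[Rplus/0]_(A : adj n | valid_adj A) \big[Rmult/1]_p f p (rst A p))).
  rewrite [X in _ <= X]big_mkcond /expect /Rsum; apply: ler_Rsum => A _.
  rewrite /prob_adj; case: ifP => _; last lra.
  apply: Req_le; rewrite /Rprod -big_split /= big_mkcond /=; apply: eq_bigr => p _.
  by rewrite /f ffunE; case: (upper n p).
apply: (Rsum_inj_le (P := @valid_adj n)) => [A A' vA vA' /ffunP h|A]; last first.
  by apply: Rprod_ge0 => p _; apply: f0.
apply: valid_adj_upper_inj => // p up.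
by move: (h p); rewrite !ffunE up.
Qed.

Lemma expect1_le : expect a b s (fun=> 1) <= 1.
Proof.
have h : forall (p : 'I_n * 'I_n) (c : bool), 0 <= 1 by move=> *; lra.
have := expect_prod_le h; rewrite [X in _ <= X]big1 => [|p _]; last by rewrite /=; lra.
by apply: Rle_trans; apply: Req_le; apply: eq_bigr => A _; rewrite big1.
Qed.

Lemma expect_le (f g : adj n -> R) :
  (forall A, f A <= g A) -> expect a b s f <= expect a b s g.
Proof.
move=> h; apply: ler_Rsum => A _; apply: Rmult_le_compat_l => //.
exact: prob_adj_ge0.
Qed.

Lemma expect_linear (I : finType) (P : pred I) (u : R) (c : I -> R) (f : I -> adj n -> R) :
  expect a b s (fun A => u + \big[Rplus/0]_(i | P i) (c i * f i A))
  = u * expect a b s (fun=> 1) + \big[Rplus/0]_(i | P i) (c i * expect a b s (f i)).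
Proof.
rewrite /expect /Rsum (big_distrr (times := Rmult)) /=.
under [X in _ = _ + X]eq_bigr do rewrite (big_distrr (times := Rmult)) /=.
rewrite exchange_big -big_split /=; apply: eq_bigr => A _.
rewrite Rmult_plus_distr_l (big_distrr (times := Rmult)) /=; congr (_ + _); first lra.
by apply: eq_bigr => i _; lra.
Qed.

End Law.

Section Chernoff.
Variables (n K : nat) (a b t lam x y : R) (s s' : assign n K).
Let p := a / INR n.
Let q := b / INR n.
Hypotheses (p01 : 0 <= p <= 1) (q01 : 0 <= q <= 1).

Lemma theta_bounds i j : 0 <= theta a b s i j <= 1.
Proof. by rewrite /theta; case: ifP. Qed.

(** The difference of the two statistics is a sum over pairs of (A - lam) D with D in {-1, 0, 1}, so
    the expectation is bounded by a product. Pairs treated alike give the factor 1; the two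
    hypotheses bound the factors for D = -1 and D = 1. *)
Lemma chernoff :
  p * exp (- (t * (1 - lam))) + (1 - p) * exp (t * lam) <= exp (- x) ->
  q * exp (t * (1 - lam)) + (1 - q) * exp (- (t * lam)) <= exp (- y) ->
  expect a b s (fun A => exp (t * (T_stat lam A s' - T_stat lam A s)))
  <= exp (- (x * INR (sep s s') + y * INR (sep s' s))).
Proof.
move=> hx hy.
pose D (z : 'I_n * 'I_n) := indR (s' z.1 == s' z.2) - indR (s z.1 == s z.2).
pose g z c := exp (t * ((indR c - lam) * D z)).
have TE A : exp (t * (T_stat lam A s' - T_stat lam A s))
    = \big[Rmult/1]_(z | upper n z) g z (A z).
  rewrite -exp_Rsum -(big_distrr (times := Rmult)) /=; congr (exp (_ * _)).
  rewrite /T_stat /Rsum !(big_distrr (times := Rmult)) /=.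
  have sub F G : \big[Rplus/0]_(z | upper n z) F z - \big[Rplus/0]_(z | upper n z) G z
      = \big[Rplus/0]_(z | upper n z) (F z - G z).
    rewrite /Rminus big_split /=; congr (_ + _).
    by apply: (big_morph Ropp) => [u v|]; lra.
  rewrite !sub; apply: eq_bigr => z _; rewrite /D; ring.
rewrite /expect /Rsum; under eq_bigr do rewrite TE.
apply: Rle_trans (expect_prod_le _ _) _; [exact: theta_bounds|by move=> *; apply/Rlt_le/exp_pos|].
have -> : exp (- (x * INR (sep s s') + y * INR (sep s' s)))
  = \big[Rmult/1]_(z | upper n z) exp (
      - (x * indR ((s z.1 == s z.2) && (s' z.1 != s' z.2))
         + y * indR ((s' z.1 == s' z.2) && (s z.1 != s z.2)))).
  rewrite -exp_Rsum; congr exp.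
  have cnt (u v : assign n K) : INR (sep u v) = \big[Rplus/0]_(z | upper n z)
      indR ((u z.1 == u z.2) && (v z.1 != v z.2)).
    rewrite /sep -sum1dep_card INR_sum big_mkcondr /=.
    by apply: eq_bigr => z _; case: ifP.
  rewrite !cnt !(big_distrr (times := Rmult)) /= -big_split /=.
  by apply: (big_morph Ropp) => [u v|]; lra.
refine (proj2 (_ : 0 <= _ <= _)).
apply: (big_ind2 (fun u v => 0 <= u <= v)) => [|u1 v1 u2 v2 [? ?] [? ?]|z _]; first lra.
  by split; [apply: Rmult_le_pos|apply: Rmult_le_compat].
have th := theta_bounds z.1 z.2.
split.
  by apply: Rplus_le_le_0_compat; apply: Rmult_le_pos; try lra; apply/Rlt_le/exp_pos.
rewrite /g /D /theta -/p -/q; case: (s z.1 == s z.2); case: (s' z.1 == s' z.2) => /=.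
- rewrite !(Rminus_diag, Rmult_0_r, Rplus_0_r, Ropp_0, exp_0); lra.
- rewrite (_ : t * ((1 - lam) * (0 - 1)) = - (t * (1 - lam))); last ring.
  rewrite (_ : t * ((0 - lam) * (0 - 1)) = t * lam); last ring.
  by rewrite (_ : - (_ + _) = - x) //; ring.
- rewrite (_ : t * ((1 - lam) * (1 - 0)) = (t * (1 - lam))); last ring.
  rewrite (_ : t * ((0 - lam) * (1 - 0)) = - (t * lam)); last ring.
  by rewrite (_ : - (_ + _) = - y) //; ring.
- rewrite !(Rminus_diag, Rmult_0_r, Rplus_0_r, Ropp_0, exp_0); lra.
Qed.
End Chernoff.

(** * The optimal tilt and the penalty *)

(** Expanding the left side leaves the cross terms q(1-p)e^t and p(1-q)e^(-t). Their product does
    not depend on t, and at this tilt they coincide, so each is the geometric mean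
    sqrt(pq(1-p)(1-q)). *)
Lemma hellinger_tilt (p q t : R) : 0 < q < 1 -> 0 < p < 1 ->
  exp t * exp t = p * (1 - q) / (q * (1 - p)) ->
  (p * exp (- t) + 1 - p) * (q * exp t + 1 - q)
  = (sqrt (p * q) + sqrt ((1 - p) * (1 - q))) ^ 2.
Proof.
move=> q01 p01 et; have et0 := exp_pos t.
have pq0 : 0 < p * q by apply: Rmult_lt_0_compat; lra.
have pq1 : 0 < (1 - p) * (1 - q) by apply: Rmult_lt_0_compat; lra.
have qp : 0 < q * (1 - p) by apply: Rmult_lt_0_compat; lra.
pose u := q * (1 - p) * exp t.
have pu : p * (1 - q) = u * exp t by rewrite /u Rmult_assoc et; field; lra.
have u0 : 0 < u by apply: Rmult_lt_0_compat.
have -> : (p * exp (- t) + 1 - p) * (q * exp t + 1 - q)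
   = p * q + (1 - p) * (1 - q) + (u + p * (1 - q) * / exp t).
  by rewrite exp_Ropp /u; field; lra.
have -> : (sqrt (p * q) + sqrt ((1 - p) * (1 - q))) ^ 2
   = p * q + (1 - p) * (1 - q) + 2 * (sqrt (p * q) * sqrt ((1 - p) * (1 - q))).
  rewrite (_ : forall x y, (x + y) ^ 2 = x * x + y * y + 2 * (x * y)) => [|x y]; last ring.
  by rewrite !sqrt_sqrt //; lra.
rewrite -sqrt_mult; try lra.
have -> : p * q * ((1 - p) * (1 - q)) = u * u.
  rewrite (_ : _ * _ = q * (1 - p) * (p * (1 - q))); last ring.
  by rewrite pu /u; ring.
by rewrite sqrt_square; [rewrite pu; field; lra|lra].
Qed.

Lemma tilted_affinity (n : nat) (a b : R) :
  (0 < n)%N -> 0 < b -> b < a -> a / INR n < 1 ->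
  let t := tstar n a b in
  0 < t /\
  ln (a / INR n * exp (- t) + 1 - a / INR n) + ln (b / INR n * exp t + 1 - b / INR n)
  = - I_rate n a b.
Proof.
move=> n0 b0 ba an1 t.
have N0 : 0 < INR n by apply: INR_gt0; lia.
have q0 : 0 < b / INR n by apply: Rdiv_lt_0_compat.
have qp : b / INR n < a / INR n by apply: Rmult_lt_compat_r => //; apply: Rinv_0_lt_compat.
set p := a / INR n in an1 qp *; set q := b / INR n in q0 qp *.
have ratioE : a * (1 - b / INR n) / (b * (1 - a / INR n)) = p * (1 - q) / (q * (1 - p)).
  have aE : a = p * INR n by rewrite /p; field; lra.
  have bE : b = q * INR n by rewrite /q; field; lra.
  by rewrite -/p -/q aE bE; field; lra.
have qp0 : 0 < q * (1 - p) by apply: Rmult_lt_0_compat; lra.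
have ratio1 : 1 < p * (1 - q) / (q * (1 - p)).
  apply: (Rmult_lt_reg_r (q * (1 - p))) => //.
  by rewrite /Rdiv Rmult_assoc Rinv_l; lra.
have t0 : 0 < t.
  by rewrite /t /tstar ratioE; have := ln_increasing 1 _ Rlt_0_1 ratio1; rewrite ln_1; lra.
have et : exp t * exp t = p * (1 - q) / (q * (1 - p)).
  by rewrite -exp_plus (_ : t + t = ln (p * (1 - q) / (q * (1 - p)))) ?exp_ln;
    [|lra|rewrite /t /tstar ratioE; lra].
split=> //.
have ? := exp_pos t; have ? := exp_pos (- t).
have A0 : 0 < p * exp (- t) + 1 - p.
  by have := Rmult_lt_0_compat p (exp (- t)); lra.
have B0 : 0 < q * exp t + 1 - q.
  by have := Rmult_lt_0_compat q (exp t); lra.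
rewrite -ln_mult // hellinger_tilt //; try lra.
rewrite ln_pow; first by rewrite /I_rate -/p -/q /=; ring.
have : 0 < sqrt (p * q) by apply: sqrt_lt_R0; apply: Rmult_lt_0_compat; lra.
by have := sqrt_pos ((1 - p) * (1 - q)); lra.
Qed.

(** The K = 2 branch of [lambda_pen] is the other formula at weight 1/2, so both cases can be
    treated together. *)
Definition pen_weight (K : nat) (w : R) : R := if K == 2%N then / 2 else w.

Lemma lambda_penE (n K : nat) (w a b : R) :
  let t := tstar n a b in let v := pen_weight K w in
  0 < t ->
  t * lambda_pen n K w a b
  = - v * ln (a / INR n * exp (- t) + 1 - a / INR n)
    + (1 - v) * ln (b / INR n * exp t + 1 - b / INR n).
Proof.
move=> t v t0; rewrite /lambda_pen /v /pen_weight -/t; case: ifP => _; field; lra.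
Qed.

(** With [lA] + [lB] = -I, the penalty gives t lam + [lA] = -(1-v)I and [lB] - t lam = -vI. The two
    exponents add up to I, so v disappears once both pair counts are at least S. *)
Lemma sep_tail (n K : nat) (w a b : R) (s s' : assign n K) (S : R) :
  (0 < n)%N -> 0 < b -> b < a -> a / INR n < 1 -> 0 <= w <= 1 ->
  0 <= I_rate n a b -> S <= INR (sep s s') -> S <= INR (sep s' s) ->
  let lam := lambda_pen n K w a b in
  expect a b s (fun A => exp (tstar n a b * (T_stat lam A s' - T_stat lam A s)))
  <= exp (- (I_rate n a b * S)).
Proof.
move=> n0 b0 ba an1 w01 I0 S1 S2 lam.
have [t0 tI] := tilted_affinity n0 b0 ba an1.
have N0 : 0 < INR n by apply: INR_gt0; lia.
have q0 : 0 < b / INR n by apply: Rdiv_lt_0_compat.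
have qp : b / INR n < a / INR n by apply: Rmult_lt_compat_r => //; apply: Rinv_0_lt_compat.
pose v := pen_weight K w.
have v01 : 0 <= v <= 1 by rewrite /v /pen_weight; case: ifP => _; lra.
have tl := lambda_penE K w t0; rewrite -/v -/lam /= in tl.
set t := tstar n a b in t0 tI tl *; set I := I_rate n a b in I0 tI *.
have ? := exp_pos t; have ? := exp_pos (- t).
set p := a / INR n in an1 qp tI tl; set q := b / INR n in q0 qp tI tl.
have A0 : 0 < p * exp (- t) + 1 - p.
  by have := Rmult_lt_0_compat p (exp (- t)); lra.
have B0 : 0 < q * exp t + 1 - q.
  by have := Rmult_lt_0_compat q (exp t); lra.
set lA := ln _ in tI tl; set lB := ln (q * _ + _ - _) in tI tl.
apply: Rle_trans (chernoff (x := (1 - v) * I) (y := v * I) s s' _ _ _ _) _; rewrite -/p -/q; try lra.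
- rewrite (_ : - (t * (1 - lam)) = - t + t * lam); last ring.
  rewrite exp_plus (_ : _ + _ = (p * exp (- t) + 1 - p) * exp (t * lam)); last ring.
  rewrite -(exp_ln _ A0) -exp_plus tl -/lA; apply: exp_le.
  by have -> : I = - lA - lB; [lra|apply: Req_le; ring].
- rewrite (_ : t * (1 - lam) = t + - (t * lam)); last ring.
  rewrite exp_plus (_ : _ + _ = (q * exp t + 1 - q) * exp (- (t * lam))); last ring.
  rewrite -(exp_ln _ B0) -exp_plus tl -/lB; apply: exp_le.
  by have -> : I = - lA - lB; [lra|apply: Req_le; ring].
apply: exp_le.
have h1 := Rmult_le_compat_l ((1 - v) * I) _ _ _ S1.
have h2 := Rmult_le_compat_l (v * I) _ _ _ S2.
have p1 : 0 <= (1 - v) * I by apply: Rmult_le_pos; lra.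
have p2 : 0 <= v * I by apply: Rmult_le_pos; lra.
have := h1 p1; have := h2 p2; lra.
Qed.

(** The affinity is at least sqrt((1-p)(1-q)) >= 1-p, with p = a/n and q = b/n. Boundedness of I
    later turns a large nI/K into a large n/K. *)
Lemma I_rate_le (n : nat) (a b eps : R) :
  0 < eps -> 0 < b / INR n < a / INR n -> a / INR n < 1 - eps ->
  I_rate n a b <= - 2 * ln eps.
Proof.
move=> e0 qp p1; rewrite /I_rate.
suff : ln eps <= ln (sqrt (a / INR n * (b / INR n)) + sqrt ((1 - a / INR n) * (1 - b / INR n))) by lra.
suff : eps <= sqrt (a / INR n * (b / INR n)) + sqrt ((1 - a / INR n) * (1 - b / INR n)).
  by case=> [/(ln_increasing _ _ e0)|->]; lra.
have := sqrt_pos (a / INR n * (b / INR n)).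
suff : eps <= sqrt ((1 - a / INR n) * (1 - b / INR n)) by lra.
rewrite -{1}(sqrt_square eps); last lra.
by apply: sqrt_le_1_alt; apply: Rmult_le_compat; lra.
Qed.

(** * Spheres around an assignment *)

(** The sum factorises over vertices, each contributing 1 for the label of [s0] and x for every
    other label. *)
Lemma dist_gen (n K : nat) (s0 : assign n K) (x : R) :
  \big[Rplus/0]_(s : assign n K) x ^ dist s s0 <= (1 + INR K * Rabs x) ^ n.
Proof.
have powE (s : assign n K) : x ^ dist s s0 = \big[Rmult/1]_i (if s i != s0 i then x else 1).
  by rewrite -big_mkcond /= Rprod_const /dist cardsE.
rewrite (eq_bigr _ (fun s _ => powE s)).
rewrite -(bigA_distr_bigA (times := Rmult) (fun i k => if k != s0 i then x else 1)) /=.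
apply: Rle_trans (Rle_abs _) _.
have -> : Rabs (\big[Rmult/1]_(i < n) \big[Rplus/0]_(k < K) (if k != s0 i then x else 1))
  = \big[Rmult/1]_(i < n) Rabs (\big[Rplus/0]_(k < K) (if k != s0 i then x else 1)).
  by apply: (big_morph Rabs) => [u v|]; [exact: Rabs_mult|exact: Rabs_R1].
rewrite -[X in _ ^ X]card_ord -Rprod_const.
refine (proj2 (_ : 0 <= _ <= _)).
apply: (big_ind2 (fun u v => 0 <= u <= v)) => [|u1 v1 u2 v2 [? ?] [? ?]|i _]; first lra.
  by split; [apply: Rmult_le_pos|apply: Rmult_le_compat].
split; first exact: Rabs_pos.
rewrite (bigD1 (s0 i)) //= eqxx /=.
apply: Rle_trans (Rabs_triang _ _) _; rewrite Rabs_R1; apply: Rplus_le_compat_l.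
rewrite (eq_bigr (fun=> x)) => [|k /negbTE -> //].
rewrite Rsum_const Rabs_mult Rabs_pos_eq; last exact: pos_INR.
apply: Rmult_le_compat_r; first exact: Rabs_pos.
by apply: Rle_INR; apply: leq_trans (max_card _) _; rewrite card_ord.
Qed.

(* The generating function [dist_gen] at x = m / (n K) bounds the size of
   the sphere of radius m by (e n K / m)^m. *)
Lemma dist_sphere (n K : nat) (s0 : assign n K) (m : nat) :
  (0 < n)%N -> (0 < K)%N ->
  INR #|[pred s : assign n K | dist s s0 == m]| * (INR m / (exp 1 * INR n * INR K)) ^ m <= 1.
Proof.
move=> n0 K0.
have N0 : 0 < INR n by apply: INR_gt0; lia.
have K0' : 0 < INR K by apply: INR_gt0; lia.
have e0 := exp_pos 1.
pose x := INR m / (INR n * INR K).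
have x0 : 0 <= x.
  by apply: Rmult_le_pos; [exact: pos_INR|apply/Rlt_le/Rinv_0_lt_compat/Rmult_lt_0_compat].
have -> : INR m / (exp 1 * INR n * INR K) = x * / exp 1 by rewrite /x; field; lra.
rewrite Rpow_mult_distr -exp_Ropp pow_exp -Rmult_assoc.
apply: (Rmult_le_reg_r (exp (INR m))); first exact: exp_pos.
rewrite Rmult_assoc -exp_plus (_ : _ * - 1 + _ = 0); last ring.
rewrite exp_0 Rmult_1_r Rmult_1_l.
apply: Rle_trans (_ : (1 + INR K * x) ^ n <= _); last first.
  apply: Rle_trans (_ : exp (INR K * x) ^ n <= _); last first.
    by rewrite pow_exp; apply/exp_le/Req_le; rewrite /x; field; lra.
  by apply: pow_incr; split; [have := Rmult_le_pos (INR K) x; lra|exact: exp_ineq1_le].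
rewrite -{2}(Rabs_pos_eq x) //; apply: Rle_trans (dist_gen s0 x).
rewrite -Rsum_const [X in X <= _]big_mkcond; apply: ler_Rsum => s _ /=.
by case: eqP => [<-|_]; [apply: Rle_refl|apply: pow_le].
Qed.

(** By [dist_sphere] the sphere of radius m has total weight at most 2^(-m). It therefore suffices
    in the union bound to dominate each term by a multiple of its weight. *)
Lemma dist_weight_sum (n K : nat) (s0 : assign n K) :
  (0 < n)%N -> (0 < K)%N ->
  \big[Rplus/0]_(s : assign n K)
     (INR (dist s s0) / (2 * exp 1 * INR n * INR K)) ^ dist s s0 <= 2.
Proof.
move=> n0 K0.
have dn (s : assign n K) : (dist s s0 < n.+1)%N.
  by rewrite ltnS -[X in (_ <= X)%N](card_ord n); exact: max_card.
rewrite (partition_big (fun s => Ordinal (dn s)) predT) //=.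
apply: Rle_trans (_ : \big[Rplus/0]_(m < n.+1) (/ 2) ^ m <= _).
  apply: ler_Rsum => m _.
  rewrite (eq_bigr (fun=> (INR m / (2 * exp 1 * INR n * INR K)) ^ m)) => [|s /eqP <- //].
  rewrite Rsum_const.
  have -> : INR m / (2 * exp 1 * INR n * INR K) = / 2 * (INR m / (exp 1 * INR n * INR K)).
    field; have N0 : 0 < INR n by apply: INR_gt0; lia.
    have K0' : 0 < INR K by apply: INR_gt0; lia.
    by have := exp_pos 1; lra.
  rewrite Rpow_mult_distr (_ : forall c u v, c * (u * v) = u * (c * v)) => [|c u v]; last ring.
  rewrite -[X in _ <= X]Rmult_1_r; apply: Rmult_le_compat_l; first by apply: pow_le; lra.
  exact: dist_sphere.
suff -> : \big[Rplus/0]_(m < n.+1) (/ 2) ^ m = 2 - (/ 2) ^ n by have := pow_le (/ 2) n; lra.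
elim: (n) => [|k IH]; first by rewrite big_ord1 /=; lra.
by rewrite big_ord_recr /= IH /=; lra.
Qed.

(** * Relabelling *)

Lemma distC (n K : nat) (s s' : assign n K) : dist s s' = dist s' s.
Proof. by apply: eq_card => i; rewrite !inE eq_sym. Qed.

Lemma dist_relabel (n K : nat) (d : {perm 'I_K}) (s s' : assign n K) :
  dist s' (relabel d s) = dist s (relabel d^-1%g s').
Proof.
apply: eq_card => i; rewrite !inE !ffunE -(inj_eq (@perm_inj _ d) (s i)) permKV.
by rewrite eq_sym.
Qed.

Lemma relabelM (n K : nat) (d d' : {perm 'I_K}) (s : assign n K) :
  relabel d' (relabel d s) = relabel (d * d')%g s.
Proof. by apply/ffunP => i; rewrite !ffunE permM. Qed.

Lemma comm_size_relabel (n K : nat) (d : {perm 'I_K}) (s : assign n K) k :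
  comm_size (relabel d s) k = comm_size s (d^-1%g k).
Proof.
apply: eq_card => i; rewrite !inE ffunE.
by rewrite -(inj_eq (@perm_inj _ d) (s i)) permKV.
Qed.

Lemma T_stat_relabel (n K : nat) (d : {perm 'I_K}) lam A (s : assign n K) :
  T_stat lam A (relabel d s) = T_stat lam A s.
Proof.
rewrite /T_stat /Rsum; congr (_ - _ * _);
  by apply: eq_bigr => p _; rewrite !ffunE (inj_eq perm_inj).
Qed.

Lemma bigmin_le (I : finType) (F : I -> nat) (x : nat) i0 :
  (\big[minn/x]_i F i <= F i0)%N.
Proof.
have : i0 \in index_enum I by rewrite mem_index_enum.
elim: (index_enum I) => [//|i r IH]; rewrite big_cons inE => /orP[/eqP <-|/IH h].
  exact: geq_minl.
by apply: leq_trans h; exact: geq_minr.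
Qed.

(** The best permutation is moved from the truth to the estimate, which leaves T and the size
    constraints unchanged, so that [s0] can stay fixed in the union bound. *)
Lemma risk_aligned (n K : nat) (s s0 : assign n K) :
  exists d : {perm 'I_K},
    risk s s0 <= INR (dist (relabel d s) s0) / INR n /\
    forall d', (dist (relabel d s) s0 <= dist (relabel d s) (relabel d' s0))%N.
Proof.
have [d _ dmin] := arg_minnP (fun d : {perm 'I_K} => dist s (relabel d s0))
  (erefl : predT (1%g : {perm _})).
exists d^-1%g; rewrite [dist _ s0]distC dist_relabel invgK; split.
  apply: Rmult_le_compat_r.
    have := pos_INR n; case=> [/Rinv_0_lt_compat|<-]; first lra.
    by rewrite Rinv_0; lra.
  apply: Rle_INR; rewrite (_ : dist _ _ = #|[set i | s i != d (s0 i)]|).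
    exact: (bigmin_le (fun d : {perm 'I_K} => #|[set i | s i != d (s0 i)]|)).
  by apply: eq_card => i; rewrite !inE ffunE.
by move=> d'; rewrite [X in (_ <= X)%N]distC [X in (_ <= X)%N]dist_relabel invgK relabelM; exact: dmin.
Qed.

(** * Pair counts for nearly balanced communities *)

Section SizeBounds.
Variables (n K : nat) (eta eps : R).
Hypotheses (K0 : (0 < K)%N) (etaeps : Rabs eta <= eps).
Let N := INR n / INR K.

Lemma size_bounds (s : assign n K) : Theta0 eta s ->
  forall k, (1 - eps) * N <= INR (comm_size s k) <= (1 + eps) * N.
Proof.
move=> h k; have := h k; have := etaeps; rewrite /Rabs; case: Rcase_abs => ? ?.
all: have N0 : 0 <= N by apply: Rmult_le_pos; [exact: pos_INR|apply/Rlt_le/Rinv_0_lt_compat/INR_gt0; lia].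
all: have E1 : (1 - eta) * INR n / INR K = (1 - eta) * N by rewrite /N /Rdiv; ring.
all: have E2 : (1 + eta) * INR n / INR K = (1 + eta) * N by rewrite /N /Rdiv; ring.
all: rewrite E1 E2; nra.
Qed.

(** The two bounds come from [sep_lower_small] and [sep_lower_large]. For eps <= 1/10 the latter
    applies since 3(1+eps) <= 4(1-eps), and its constant (1-eps)/8 is at least 1/10. *)
Lemma sep_lower (s s' : assign n K) (m : nat) :
  eps <= / 10 -> Theta0 eta s -> Theta0 eta s' ->
  m = dist s s' -> (forall d, (m <= dist s' (relabel d s))%N) ->
  INR m * ((1 - eps) * N - INR m) <= INR (sep s s') /\
  INR m * (N / 10) <= INR (sep s s').
Proof.
move=> eps10 hs hs' mE mmin.
have b1 := size_bounds hs; have b2 := size_bounds hs'.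
pose k0 : 'I_K := Ordinal K0.
have [kL _ hL] := arg_minnP (comm_size s) (erefl : predT k0).
have [k1 _ h1] := arg_maxnP (comm_size s) (erefl : predT k0).
have [k2 _ h2] := arg_maxnP (comm_size s') (erefl : predT k0).
have hL' k : (comm_size s kL <= comm_size s k)%N by apply: hL.
have m0 := pos_INR m.
have N0 : 0 <= N by apply: Rmult_le_pos; [exact: pos_INR|apply/Rlt_le/Rinv_0_lt_compat/INR_gt0; lia].
split.
  have := Rle_INR (sep_lower_small s' hL').
  rewrite -mE plus_INR !mult_INR.
  have := Rmult_le_compat_l _ _ _ m0 (proj1 (b1 kL)); lra.
pose U := maxn (comm_size s k1) (comm_size s' k2).
have UE : INR U <= (1 + eps) * N.
  by rewrite /U /maxn; case: ifP => _; [apply: (proj2 (b2 k2))|apply: (proj2 (b1 k1))].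
have [k|k||d hd] := @sep_lower_large n K s s' (comm_size s kL) U.
- by rewrite hL' leq_max; move: (h1 k erefl) => /= ->.
- by rewrite leq_max; move: (h2 k erefl) => /= ->; rewrite orbT.
- apply: INR_leq; rewrite !mult_INR /=; have := proj1 (b1 kL); nra.
have := Rle_INR (leq_trans (leq_mul (leqnn _) (mmin d)) hd).
rewrite !mult_INR (_ : INR 8 = 8); last by rewrite /=; ring.
have := Rmult_le_compat_l _ _ _ m0 (proj1 (b1 kL)).
have := Rmult_le_pos _ _ m0 N0; nra.
Qed.
End SizeBounds.

(** * Risk at a fixed size *)

Section FixedSize.
Variables (n K : nat) (a b w eta eps : R) (est : adj n -> assign n K) (s0 : assign n K).
Let I := I_rate n a b.
Let N := INR n / INR K.
Let G := INR n * I / INR K.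
Let lam := lambda_pen n K w a b.
Hypotheses (n0 : (0 < n)%N) (K2 : (2 <= K)%N).
Hypotheses (b0 : 0 < b) (ba : b < a) (an1 : a / INR n < 1) (w01 : 0 <= w <= 1).
Hypotheses (eps0 : 0 < eps) (eps10 : eps <= / 10) (etaeps : Rabs eta <= eps).
Hypothesis est_max : forall A, Theta0 eta (est A) /\
  forall s : assign n K, Theta0 eta s -> T_stat lam A s <= T_stat lam A (est A).
Hypothesis hs0 : Theta0 eta s0.
(** [G1] absorbs the entropy factor 2eK; [G2] makes exp(-G/20) smaller than every weight with more
    than eps N errors; [G3] makes such error counts exceed 20; [G4] absorbs the final factor 3. *)
Hypotheses (G1 : ln 2 + 1 + ln (INR K) <= 2 * eps * G)
  (G2 : ln 2 + 1 + 2 * ln (INR K) - ln eps <= G / 20)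
  (G3 : 20 <= eps * N) (G4 : 2 <= eps * G).

Definition far_aligned (s : assign n K) : Prop :=
  [/\ Theta0 eta s, forall d, (dist s s0 <= dist s (relabel d s0))%N
   & INR n * exp (- (1 - 4 * eps) * G) <= INR (dist s s0)].

(** Membership involves real inequalities, so it is decided classically in order to index a finite
    sum. *)
Let far (s : assign n K) : bool :=
  if excluded_middle_informative (far_aligned s) then true else false.

Let farP s : reflect (far_aligned s) (far s).
Proof. by rewrite /far; case: excluded_middle_informative => h; constructor. Qed.

Let n0R : 0 < INR n. Proof. by apply: INR_gt0; lia. Qed.
Let K0R : 0 < INR K. Proof. by apply: INR_gt0; lia. Qed.
Let G0 : 0 < G. Proof. by nra. Qed.
Let I0 : 0 <= I.
Proof.
have -> : I = G * (INR K / INR n) by rewrite /G; field; lra.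
by apply: Rmult_le_pos; [lra|apply/Rlt_le/Rdiv_lt_0_compat].
Qed.
Let NI : N * I = G. Proof. by rewrite /N /G; field; lra. Qed.

(** Either the aligned estimate has few errors, or it is itself a term of the sum. In the latter
    case its exponent is nonnegative because the estimate maximises T, so the term is at least its
    share of errors. *)
Lemma risk_pointwise A :
  risk (est A) s0 <= exp (- (1 - 4 * eps) * G)
   + \big[Rplus/0]_(s | far s) (INR (dist s s0) / INR n *
        exp (tstar n a b * (T_stat lam A s - T_stat lam A s0))).
Proof.
have [t0 _] := tilted_affinity n0 b0 ba an1.
have term0 s : 0 <= INR (dist s s0) / INR n *
        exp (tstar n a b * (T_stat lam A s - T_stat lam A s0)).
  apply: Rmult_le_pos; last exact/Rlt_le/exp_pos.
  by apply: Rmult_le_pos; [exact: pos_INR|apply/Rlt_le/Rinv_0_lt_compat].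
have [d [riskd mind]] := risk_aligned (est A) s0.
set s := relabel d (est A) in riskd mind.
apply: Rle_trans riskd _.
have [near|/Rnot_lt_le fars] := Rlt_dec (INR (dist s s0)) (INR n * exp (- (1 - 4 * eps) * G)).
  have sum0 : 0 <= \big[Rplus/0]_(s | far s) (INR (dist s s0) / INR n *
        exp (tstar n a b * (T_stat lam A s - T_stat lam A s0))).
    by apply: Rsum_ge0.
  apply: Rle_trans (_ : exp (- (1 - 4 * eps) * G) <= _); last lra.
  apply: (Rmult_le_reg_r (INR n)) => //; rewrite /Rdiv Rmult_assoc Rinv_l; lra.
have fs : far s.
  apply/farP; split => // k; rewrite /s comm_size_relabel.
  exact: (proj1 (est_max A)).
apply: Rle_trans (_ : INR (dist s s0) / INR n *
        exp (tstar n a b * (T_stat lam A s - T_stat lam A s0)) <= _); last first.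
  have := Rsum_term_le (F := fun s => INR (dist s s0) / INR n *
        exp (tstar n a b * (T_stat lam A s - T_stat lam A s0))) (fun s _ => term0 s) fs.
  by have := exp_pos (- (1 - 4 * eps) * G); lra.
rewrite -[X in X <= _]Rmult_1_r; apply: Rmult_le_compat_l.
  by apply: Rmult_le_pos; [exact: pos_INR|apply/Rlt_le/Rinv_0_lt_compat].
rewrite -exp_0; apply: exp_le; apply: Rmult_le_pos; first lra.
by rewrite /s T_stat_relabel; have := proj2 (est_max A) _ hs0; lra.
Qed.

Let E := 2 * exp 1 * INR K * exp (- (1 - 2 * eps) * G).

Lemma exp_lnK : exp (ln 2 + 1 + ln (INR K)) = 2 * exp 1 * INR K.
Proof. by rewrite !exp_plus !exp_ln; lra. Qed.

(** Put g = exp(-(1-2 eps)G). The pair count gives g^m, and the threshold on m with [G1] gives g <=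
    z. Since m/n = 2eKz, one factor g is kept in [E] and only the other m-1 are replaced by z; this
    retains the decay in G. *)
Lemma term_near m z S : (0 < m)%N ->
  z = INR m / (2 * exp 1 * INR n * INR K) ->
  INR n * exp (- (1 - 4 * eps) * G) <= INR m -> INR m <= eps * N ->
  INR m * ((1 - eps) * N - INR m) <= S ->
  INR m / INR n * exp (- (I * S)) <= E * z ^ m.
Proof.
move=> m0 zE hm meps hS; have e0 := exp_pos 1; have m0R := pos_INR m.
have step : exp (- (1 - 2 * eps) * G) <= z.
  apply: (Rmult_le_reg_r (2 * exp 1 * INR K)); first nra.
  rewrite -{1}exp_lnK -exp_plus.
  apply: Rle_trans (_ : exp (- (1 - 4 * eps) * G) <= _); first by apply: exp_le; lra.
  apply: (Rmult_le_reg_l (INR n)) => //.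
  by apply: Rle_trans hm _; apply: Req_le; rewrite zE; field; lra.
apply: Rle_trans (_ : INR m / INR n * exp (- (1 - 2 * eps) * G) ^ m <= _).
  apply: Rmult_le_compat_l.
    by apply: Rmult_le_pos; [exact: pos_INR|apply/Rlt_le/Rinv_0_lt_compat].
  rewrite pow_exp; apply: exp_le; rewrite -NI.
  have h : INR m * ((1 - 2 * eps) * N) <= S by nra.
  have := Rmult_le_compat_l _ _ _ I0 h; lra.
case: m m0 zE {hm meps hS m0R} => // m _ zE.
rewrite -!tech_pow_Rmult /E.
set g := exp (- (1 - 2 * eps) * G) in step *; have g0 : 0 < g by exact: exp_pos.
have -> : INR m.+1 / INR n = 2 * exp 1 * INR K * z by rewrite zE; field; lra.
rewrite !Rmult_assoc; do 3 (apply: Rmult_le_compat_l; first lra).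
rewrite -!Rmult_assoc (Rmult_comm z); apply: Rmult_le_compat_l; first nra.
by apply: pow_incr; lra.
Qed.

(** Half of the exponent mG/10 gives exp(-G/20)^m <= z^m by [G2]; the other half is at least G
    because m > 20, and exp(-G) <= [E]. *)
Lemma term_far m z S : (m <= n)%N ->
  z = INR m / (2 * exp 1 * INR n * INR K) ->
  eps * N < INR m -> INR m * (N / 10) <= S ->
  INR m / INR n * exp (- (I * S)) <= E * z ^ m.
Proof.
move=> mn zE meps hS; have e0 := exp_pos 1; have m0R := pos_INR m.
have step : exp (- (G / 20)) <= z.
  apply: Rle_trans (_ : eps / (2 * exp 1 * INR K * INR K) <= _).
    apply: (Rmult_le_reg_r (2 * exp 1 * INR K * INR K)); first by apply: Rmult_lt_0_compat; nra.
    rewrite (_ : eps / _ * _ = eps); last by field; lra.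
    have -> : 2 * exp 1 * INR K * INR K = exp (ln 2 + 1 + ln (INR K) + ln (INR K)).
      by rewrite exp_plus exp_lnK exp_ln.
    rewrite -exp_plus.
    by rewrite -[X in _ <= X](exp_ln eps) //; apply: exp_le; lra.
  rewrite zE (_ : eps / _ = eps * N * / (2 * exp 1 * INR n * INR K)).
    apply: Rmult_le_compat_r; last lra.
    by apply/Rlt_le/Rinv_0_lt_compat; repeat apply: Rmult_lt_0_compat => //; lra.
  by rewrite /N; field; lra.
apply: Rle_trans (_ : exp (- G) * exp (- (G / 20)) ^ m <= _).
  rewrite pow_exp -exp_plus -[X in _ <= X]Rmult_1_l.
  apply: Rmult_le_compat.
  - by apply: Rmult_le_pos; [exact: pos_INR|apply/Rlt_le/Rinv_0_lt_compat].
  - exact/Rlt_le/exp_pos.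
  - apply: (Rmult_le_reg_r (INR n)) => //; rewrite /Rdiv Rmult_assoc Rinv_l; last lra.
    by have := Rle_INR mn; lra.
  apply: exp_le; have := Rmult_le_compat_l _ _ _ I0 hS.
  have -> : I * (INR m * (N / 10)) = INR m * (G / 10) by rewrite -NI; field.
  have : 20 * G <= INR m * G by apply: Rmult_le_compat_r; lra.
  lra.
apply: Rmult_le_compat; [exact/Rlt_le/exp_pos|by apply: pow_le; exact/Rlt_le/exp_pos| |].
  rewrite /E -exp_lnK -exp_plus; apply: exp_le.
  have : 0 < ln 2 by have := ln_lt_2; lra.
  have : 0 <= ln (INR K).
    have : 1 <= INR K by apply: (Rle_INR (m := 1)); lia.
    by case=> [/(ln_increasing 1 _ Rlt_0_1)|<-]; rewrite ln_1; lra.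
  by have := Rmult_le_pos eps G; lra.
by apply: pow_incr; split=> //; apply/Rlt_le/exp_pos.
Qed.

Lemma risk_bound_fixed :
  expect a b s0 (fun A => risk (est A) s0) <= exp (- (1 - 5 * eps) * G).
Proof.
have q0 : 0 < b / INR n by apply: Rdiv_lt_0_compat.
have qp : b / INR n < a / INR n by apply: Rmult_lt_compat_r => //; apply: Rinv_0_lt_compat.
have th : forall i j, 0 <= theta a b s0 i j <= 1 by apply: theta_bounds; lra.
apply: Rle_trans (expect_le th risk_pointwise) _.
rewrite expect_linear.
set u := exp _.
have u0 : 0 < u by apply: exp_pos.
have E0 : 0 <= E.
  rewrite /E; apply: Rmult_le_pos; last exact/Rlt_le/exp_pos.
  by have := exp_pos 1; nra.
apply: Rle_trans (_ : u + 2 * E <= _).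
  apply: Rplus_le_compat.
    by have := Rmult_le_compat_l _ _ _ (Rlt_le _ _ u0) (expect1_le th); lra.
  apply: Rle_trans (_ : E * \big[Rplus/0]_(s : assign n K)
     (INR (dist s s0) / (2 * exp 1 * INR n * INR K)) ^ dist s s0 <= _); last first.
    rewrite (Rmult_comm 2 E); apply: Rmult_le_compat_l => //.
    by apply: dist_weight_sum => //; lia.
  rewrite (big_distrr (times := Rmult)) /= big_mkcond; apply: ler_Rsum => s _.
  have mn : (dist s s0 <= n)%N by rewrite -[X in (_ <= X)%N](card_ord n); exact: max_card.
  have z0 : 0 <= (INR (dist s s0) / (2 * exp 1 * INR n * INR K)).
    apply: Rmult_le_pos; first exact: pos_INR.
    apply/Rlt_le/Rinv_0_lt_compat; have := exp_pos 1 => ?.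
    by repeat apply: Rmult_lt_0_compat => //; lra.
  case: farP => [[hs mind hm]|_]; last by apply: Rmult_le_pos => //; exact: pow_le.
  have [m0|m0] := posnP (dist s s0).
    by rewrite m0 /Rdiv Rmult_0_l Rmult_0_l /=; lra.
  have K1 : (0 < K)%N by lia.
  have [small1 large1] := sep_lower K1 etaeps eps10 hs hs0 erefl (fun d =>
     leq_trans (mind d^-1%g) (eq_leq (esym (dist_relabel d s s0)))).
  have [small2 large2] := sep_lower K1 etaeps eps10 hs0 hs (distC s s0) mind.
  have tail S := sep_tail (s := s0) (s' := s) (S := S) n0 b0 ba an1 w01 I0.
  have dn0 : 0 <= INR (dist s s0) / INR n.
    by apply: Rmult_le_pos; [exact: pos_INR|apply/Rlt_le/Rinv_0_lt_compat].
  have [mN|/Rnot_le_lt mN] := Rle_dec (INR (dist s s0)) (eps * N).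
    apply: Rle_trans (term_near m0 erefl hm mN (Rle_refl _)).
    by apply: Rmult_le_compat_l => //; apply: tail.
  apply: Rle_trans (term_far mn erefl mN (Rle_refl _)).
  by apply: Rmult_le_compat_l => //; apply: tail.
(* By [G1], [E] <= [u], so the total is at most 3 [u], and 3 <= 1 + eps G <= exp(eps G) by [G4]. *)
have -> : - (1 - 5 * eps) * G = - (1 - 4 * eps) * G + eps * G by ring.
rewrite exp_plus -/u.
have : E <= u.
  by rewrite /E /u -exp_lnK -exp_plus; apply: exp_le; lra.
have := exp_ineq1_le (eps * G).
nra.
Qed.
End FixedSize.

(** * Letting the tolerance tend to 0 *)

Lemma last_true (Q : nat -> Prop) (n : nat) :
  (exists2 k, (k <= n)%N & Q k) ->
  exists k, Q k /\ forall j, (j <= n)%N -> Q j -> (j <= k)%N.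
Proof.
elim: n => [|n IH] [k kn Qk].
  by exists k; split=> // j; lia.
have [Qn|nQn] := classic (Q n.+1); first by exists n.+1.
have [|k' [Qk' maxk']] := IH.
  by exists k => //; case: (ltngtP k n.+1) kn => // ek; rewrite ek in Qk.
exists k'; split=> // j jn Qj; apply: maxk' => //.
by case: (ltngtP j n.+1) jn => // ej; rewrite ej in Qj.
Qed.

(** For each n take the largest k <= n for which the tolerance 1/(k+1) is admissible; the cap k <= n
    makes it exist. Every fixed j is eventually admissible, so k tends to infinity, without any
    monotonicity of [P]. *)
Lemma diagonal_rate (P : nat -> R -> Prop) :
  (forall k : nat, exists N, forall n, (N <= n)%N -> P n (/ INR k.+1)) ->
  exists e : nat -> R, Un_cv e 0 /\ exists N, forall n, (N <= n)%N -> P n (e n).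
Proof.
move=> hP; have [N0 hN0] := hP 0%N.
have [k hk] : exists k : nat -> nat, forall n, (N0 <= n)%N ->
    P n (/ INR (k n).+1) /\ forall j, (j <= n)%N -> P n (/ INR j.+1) -> (j <= k n)%N.
  apply: (choice (fun n k => (N0 <= n)%N -> P n (/ INR k.+1) /\
    forall j, (j <= n)%N -> P n (/ INR j.+1) -> (j <= k)%N)) => n.
  have [n0|n0] := leqP N0 n; last by exists 0%N.
  have [|k hk] := @last_true (fun k => P n (/ INR k.+1)) n; last by exists k.
  by exists 0%N => //; exact: hN0.
exists (fun n => / INR (k n).+1); split; last by exists N0 => n /hk[].
move=> x x0; have [j [jx j0]] := archimed_cor1 x x0.
have [Nj hNj] := hP j.
exists (maxn N0 (maxn Nj j)) => n /leP; rewrite !geq_max => /and3P[n0 nj jn].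
have [_ /(_ j jn (hNj n nj)) jk] := hk n n0.
rewrite /Rdist Rminus_0_r Rabs_pos_eq; last first.
  by apply/Rlt_le/Rinv_0_lt_compat/INR_gt0; lia.
apply: Rle_lt_trans jx; apply: Rinv_le_contravar; first by apply: INR_gt0; lia.
by apply: Rle_INR; lia.
Qed.

Theorem theorem5 (eps0 : R) (eta : nat -> R) (K : nat -> nat)
  (a b : nat -> R) (w : R)
  (est : forall n : nat, adj n -> assign n (K n)) :
  (0 < eps0)%R ->
  Un_cv eta 0%R ->
  (forall n : nat, (2 <= K n)%N) ->
  (forall n : nat, (0 < n)%N ->
     (eps0 < b n < a n)%R /\ (a n / INR n < 1 - eps0)%R) ->
  cv_infty (fun n : nat =>
     (INR n * I_rate n (a n) (b n) / (INR (K n) * ln (INR (K n))))%R) ->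
  (0 <= w <= 1)%R ->
  (* est n is a (tie-breaking) selection of argmax over Theta^0 of T *)
  (forall (n : nat) (A : adj n),
     Theta0 (eta n) (est n A) /\
     (forall s : assign n (K n), Theta0 (eta n) s ->
        (T_stat (lambda_pen n (K n) w (a n) (b n)) A s
         <= T_stat (lambda_pen n (K n) w (a n) (b n)) A (est n A))%R)) ->
  exists delta : nat -> R, Un_cv delta 0%R /\
    exists N : nat, forall n : nat, (N <= n)%N ->
      forall s : assign n (K n), Theta0 (eta n) s ->
        (expect (a n) (b n) s (fun A => risk (est n A) s)
         <= exp (- (1 + delta n) * (INR n * I_rate n (a n) (b n) / INR (K n))))%R.
Proof.
move=> e00 eta0 K2 hab hG w01 hest.
pose G n := INR n * I_rate n (a n) (b n) / INR (K n).
suff [e [e0 [N hN]]] : exists e, Un_cv e 0 /\ exists N, forall n, (N <= n)%N ->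
    forall s : assign n (K n), Theta0 (eta n) s ->
      expect (a n) (b n) s (fun A => risk (est n A) s) <= exp (- (1 - e n) * G n).
  exists (fun n => - e n); split; last by exists N => n; exact: hN.
  by rewrite -Ropp_0; exact: CV_opp.
apply: (diagonal_rate (P := fun n e => forall s : assign n (K n), Theta0 (eta n) s ->
      expect (a n) (b n) s (fun A => risk (est n A) s) <= exp (- (1 - e) * G n))) => k.
have k0 : 0 < INR k.+1 by apply: INR_gt0; lia.
have k1 : 1 <= INR k.+1 by apply: (Rle_INR (m := 1)); lia.
have ik0 := Rinv_0_lt_compat _ k0.
have ik1 : / INR k.+1 <= 1 by rewrite -Rinv_1; apply: Rinv_le_contravar; lra.
(* Small enough for both eps <= 1/10 and 5 eps <= 1/(k+1), the loss in [risk_bound_fixed]. *)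
pose eps := / INR k.+1 / 10.
have eps_pos : 0 < eps by rewrite /eps; lra.
have eps10 : eps <= / 10 by rewrite /eps; lra.
have ie0 := Rinv_0_lt_compat _ eps_pos.
have lneps : ln eps <= 0.
  by rewrite -ln_1; apply/Rlt_le/ln_increasing; lra.
have [p1 pe0] : a 1%N / INR 1 < 1 - eps0 /\ eps0 < 1.
  have [//|[? ?] h] := hab 1%N; split=> //.
  by move: h; rewrite /= Rdiv_1_r; lra.
have lneps0 : ln eps0 < 0 by rewrite -ln_1; apply: ln_increasing.
pose C := - 2 * ln eps0.
have C0 : 0 < C by rewrite /C; lra.
(* The summands serve, in order, n/K >= 20/eps (through G <= C n/K), the bound by G/20, and the two
   bounds by multiples of eps G. *)
pose M := 20 * / eps * C + 20 * (2 - ln eps) + 2 * / eps.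
have Ce : 0 < / eps * C by apply: Rmult_lt_0_compat.
(* The factor 3 pays for 1 + ln K <= 3 ln K, valid since ln K >= ln 2 > 1/2. *)
have [N1 hN1] := hG (3 * M).
have [N2 hN2] := eta0 eps eps_pos.
exists (maxn 1 (maxn N1 N2)) => n; rewrite !geq_max => /and3P[n0 /leP n1 /leP n2] s hs.
have n0R : 0 < INR n by apply: INR_gt0; lia.
have K2R : 2 <= INR (K n) by apply: (Rle_INR (m := 2)).
have lnK : ln 2 <= ln (INR (K n)).
  by case: K2R => [/(ln_increasing 2 _ Rlt_0_2)|<-]; lra.
have ln2 := ln_lt_2.
have GM : M * (1 + ln (INR (K n))) <= G n.
  have := hN1 n n1.
  rewrite (_ : _ / _ = G n / ln (INR (K n))); last by rewrite /G; field; lra.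
  have lnK0 : 0 < ln (INR (K n)) by lra.
  move/(Rmult_lt_compat_r _ _ _ lnK0).
  rewrite (_ : G n / _ * _ = G n); last by field; lra.
  suff : M * (1 + ln (INR (K n))) <= 3 * M * ln (INR (K n)) by lra.
  have : 0 < M by rewrite /M; lra.
  nra.
have [[b0 ba] an1] := hab n n0.
have q0 : 0 < b n / INR n by apply: Rdiv_lt_0_compat; lra.
have qp : b n / INR n < a n / INR n by apply: Rmult_lt_compat_r => //; apply: Rinv_0_lt_compat.
have IC : I_rate n (a n) (b n) <= C by apply: I_rate_le.
have etae : Rabs (eta n) <= eps.
  by have := hN2 n n2; rewrite /Rdist Rminus_0_r; lra.
set L := 1 + ln (INR (K n)) in GM.
have L1 : 1 <= L by rewrite /L; lra.
have ML : M * L = 20 * / eps * C * L + 20 * (2 - ln eps) * L + 2 * / eps * L.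
  by rewrite /M; ring.
have t1 : 20 * / eps * C <= 20 * / eps * C * L by nra.
have t2 : 0 <= 20 * (2 - ln eps) * L by apply: Rmult_le_pos; lra.
have t3 : 2 * / eps <= 2 * / eps * L by nra.
have epsG x : x * / eps <= G n -> x <= eps * G n.
  move=> h; have := Rmult_le_compat_l _ _ _ (Rlt_le _ _ eps_pos) h.
  by rewrite (Rmult_comm x) -Rmult_assoc Rinv_r; lra.
have GN : G n <= INR n / INR (K n) * C.
  have -> : G n = INR n / INR (K n) * I_rate n (a n) (b n) by rewrite /G; field; lra.
  by apply: Rmult_le_compat_l => //; apply/Rlt_le/Rdiv_lt_0_compat; lra.
have GLe : 2 * L <= eps * G n by apply: epsG; lra.
apply: Rle_trans (risk_bound_fixed (eps := eps) (est := est n) n0 (K2 n) _ ba _ w01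
  eps_pos eps10 etae (hest n) hs _ _ _ _) _; rewrite -/(G n); try lra.
- by have := ln_increasing 2 (exp 1); rewrite ln_exp; have := exp_ineq1 1; rewrite /L in GLe; lra.
- have : ln 2 < 1 by have := ln_increasing 2 (exp 1); rewrite ln_exp; have := exp_ineq1 1; lra.
  have : (2 - ln eps) * L <= G n / 20 by lra.
  rewrite /L in L1 *; nra.
- apply: (Rmult_le_reg_r C) => //.
  have h : 20 * C * / eps <= G n by lra.
  by have := epsG _ h; have := Rmult_le_compat_l _ _ _ (Rlt_le _ _ eps_pos) GN; lra.
apply: exp_le.
have : 0 <= G n by nra.
have : 5 * eps <= / INR k.+1 by rewrite /eps; lra.
nra.
Qed.
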